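(* Let $\Omega\subset\mathbb{R}^d$ be a bounded polyhedral domain with simplicial mesh $\mathcal{T}_h$, and let $r\ge1$. For each $f\in\Delta$ let $\Phi_f=\{\phi_{f,1},\dots,\phi_{f,N_f}\}$ be a basis of the space $Q^{*}_{f,r}$, $N_f=\dim Q^{*}_{f,r}$, and suppose that there are positive constants $\alpha_0,\beta_0$, independent of $f\in\Delta$, such that $$\alpha_0\sum_kc_{f,k}^2\le\Big\|\sum_kc_{f,k}\phi_{f,k}\Big\|_{L^2}^2\le\beta_0\sum_kc_{f,k}^2\qquad\text{for all }f\in\Delta\text{ and all real coefficients }\{c_{f,k}\}_k.$$ Then the frame $\Phi=\{\Phi_f\}_{f\in\Delta}$ of the space $\mathcal{P}_r(\mathcal{T}_h)$, equipped with the $L^2(\Omega)$ inner product, satisfies $$\mathcal{K}(\Phi)\le a^{-1}b\,(\alpha_0^{-1}\beta_0),$$ where $a$ and $b$ are the overlap constant and the $L^2$ stability constant of the bubble transform for the decomposition $\mathcal{P}_r(\mathcal{T}_h)=\sum_{f\in\Delta}Q^{*}_{f,r}$, as specified in the context.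
   Context: Throughout, $\Omega\subset\mathbb{R}^d$ is a bounded polyhedral domain, $\mathcal{T}_h$ is a fixed (conforming) simplicial mesh of $\Omega$, and $\|\cdot\|_{L^2}$ is the norm of $L^2(\Omega)$. For $r\ge1$, $\mathcal{P}_r(\mathcal{T}_h)$ is the space of continuous functions on $\Omega$ whose restriction to each $T\in\mathcal{T}_h$ is a polynomial of degree at most $r$. $\Delta_m$ is the set of all $m$-dimensional subsimplexes of $\mathcal{T}_h$, and $\Delta=\bigcup_{m=0}^d\Delta_m$ (so $\Delta_d=\mathcal{T}_h$). For $f\in\Delta$, the macroelement $\Omega_f$ is the union of all $T\in\mathcal{T}_h$ having $f$ as a subsimplex. For each vertex $x_j\in\Delta_0$, $\lambda_j$ is the continuous piecewise linear function on $\mathcal{T}_h$ equal to $1$ at $x_j$ and $0$ at all other vertices. For $m\ge0$ let $$S_m^c=\Big\{\lambda=(\lambda_0,\dots,\lambda_m)\in\mathbb{R}^{m+1}:\ \sum_{j=0}^m\lambda_j\le1,\ \lambda_j\ge0\Big\},\qquad S_m=\Big\{\lambda\in S_m^c:\ \sum_{j=0}^m\lambda_j=1\Big\}.$$ $Q_r(S_m^c)$ is the space of polynomials of degree at most $r$ on $S_m^c$ that vanish on $\partial S_m^c\setminus S_m$. For $f=[x_0,\dots,x_m]\in\Delta_m$ with $m<d$, let $\lambda_f=(\lambda_0,\dots,\lambda_m):\Omega\to S_m^c$ be the map given by the functions $\lambda_j$ associated with the vertices of $f$, let $\lambda_f^{*}v=v\circ\lambda_f$, and define $Q^{*}_{f,r}=\lambda_f^{*}(Q_r(S_m^c))$;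 its elements are in $\mathcal{P}_r(\mathcal{T}_h)$ and vanish outside $\Omega_f$. For $f\in\Delta_d=\mathcal{T}_h$, $Q^{*}_{f,r}$ is the space of polynomials of degree at most $r$ on $f$ that vanish on $\partial f$, extended by zero to $\Omega$. The constants $a$ and $b$ are as follows. The bubble transform (a known construction of Falk and Winther, depending on the mesh $\mathcal{T}_h$ but not on $r$) provides linear operators $B_f$, $f\in\Delta$, such that $\sum_{f\in\Delta}B_fu=u$, such that $B_fu\in Q^{*}_{f,r}$ whenever $u\in\mathcal{P}_r(\mathcal{T}_h)$, and such that $\sum_{f\in\Delta}\|B_fu\|_{L^2}^2\le b\|u\|_{L^2}^2$ with a constant $b>0$ not depending on $u$. The constant $a>0$, depending only on the number of overlaps of the subdomains $\Omega_f$, is such that $a\|\sum_{f\in\Delta}u_f\|_{L^2}^2\le\sum_{f\in\Delta}\|u_f\|_{L^2}^2$ whenever each $u_f\in L^2(\Omega)$ is supported in $\Omega_f$. In particular $\mathcal{P}_r(\mathcal{T}_h)=\sum_{f\in\Delta}Q^{*}_{f,r}$ (in general not a direct sum). These properties are recalled facts that may be used. A frame of a finite dimensional real Hilbert space $W$ is a finite family $\Phi=\{\phi_k\}$ of elements spanning $W$ (not necessarily linearly independent). Its condition number is $\mathcal{K}(\Phi)=\beta/\alpha$, where $$\alpha=\inf_{0\ne u\in W}\frac{\|u\|_W^2}{\inf_{c:\,u=\sum_kc_k\phi_k}\|c\|_{\ell^2}^2},\qquad\beta=\sup_{0\ne u\in W}\frac{\|u\|_W^2}{\inf_{c:\,u=\sum_kc_k\phi_k}\|c\|_{\ell^2}^2}.$$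 Here $W=\mathcal{P}_r(\mathcal{T}_h)$ with the $L^2(\Omega)$ inner product. *)

(* Defs.v *)
From HB Require Import structures.
From mathcomp Require Import all_boot all_order all_algebra.
From mathcomp Require Import all_classical all_reals all_analysis.
(* The notations of mpoly clash with those of the analysis library. *)
From mathcomp.multinomials Require Import (canonicals, coercions) mpoly.

Set Implicit Arguments.
Unset Strict Implicit.
Unset Printing Implicit Defensive.

Import Order.TTheory GRing.Theory Num.Theory.
Import numFieldNormedType.Exports.

Local Open Scope classical_set_scope.
Local Open Scope ring_scope.

(* 'rV[R]_n carries the sigma-algebra generated by the coordinates, i.e. the
   product of n copies of the Borel sigma-algebra of R. *)
Fact rV_display : measure_display. Proof. exact: default_measure_display. Qed.

Section measurable_rV.
Context (R : realType) (n : nat).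

Let coord (i : 'I_n) (v : 'rV[R]_n) : measurableTypeR R := v ord0 i.

Let rV_set0 : g_sigma_preimage coord set0.
Proof. exact: sigma_algebra0. Qed.

Let rV_setC A : g_sigma_preimage coord A -> g_sigma_preimage coord (~` A).
Proof. exact: sigma_algebraC. Qed.

Let rV_bigcup (F : (set 'rV[R]_n)^nat) :
  (forall i, g_sigma_preimage coord (F i)) ->
  g_sigma_preimage coord (\bigcup_i (F i)).
Proof. exact: sigma_algebra_bigcup. Qed.

HB.instance Definition _ := @isMeasurable.Build rV_display 'rV[R]_n
  (g_sigma_preimage coord) rV_set0 rV_setC rV_bigcup.

End measurable_rV.

Lemma measurable_coord (R : realType) n (i : 'I_n) :
  measurable_fun [set: 'rV[R]_n] (fun v => v ord0 i : measurableTypeR R).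
Proof.
move=> _ Y mY; rewrite setTI; apply: sub_sigma_algebra => /=.
rewrite -bigcup_seq/=; exists i => /=; first by rewrite mem_index_enum.
by exists Y => //; rewrite setTI.
Qed.

Lemma measurable_to_rV d (T : measurableType d) (R : realType) n
    (f : T -> 'rV[R]_n) :
  (forall i, measurable_fun [set: T]
     (fun x => f x ord0 i : measurableTypeR R)) ->
  measurable_fun [set: T] f.
Proof.
move=> mf _ A mA; rewrite setTI.
pose coord (i : 'I_n) (v : 'rV[R]_n) : measurableTypeR R := v ord0 i.
have : preimage_set_system [set: T] f (g_sigma_preimage coord) `<=` measurable.
  rewrite -g_sigma_preimage_comp.
  apply: smallest_sub; first exact: sigma_algebra_measurable.
  case: n => [|n] in f mf coord A mA *; first by rewrite big_ord0.
  rewrite -bigcup_mkord_ord; apply: bigcup_sub => i Ii.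
  by move=> B [C mC <-]; exact: mf.
by apply; exists A => //; rewrite setTI.
Qed.

Section lebesgue_rV_step.
Context (R : realType) (n : nat).
Variable mu : {sigma_finite_measure set 'rV[R]_n -> \bar R}.

Definition cons_rV (p : measurableTypeR R * 'rV[R]_n) : 'rV[R]_n.+1 :=
  row_mx (const_mx p.1 : 'rV_1) p.2.

Definition uncons_rV (v : 'rV[R]_n.+1) : measurableTypeR R * 'rV[R]_n :=
  (v ord0 ord0, \row_i v ord0 (lift ord0 i)).

Lemma cons_rV0 p : cons_rV p ord0 ord0 = p.1.
Proof.
by rewrite mxE; case: splitP => [j _|k //]; rewrite mxE.
Qed.

Lemma cons_rV_lift p i : cons_rV p ord0 (lift ord0 i) = p.2 ord0 i.
Proof.
rewrite mxE; case: splitP => [j|k]; first by rewrite ord1.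
by move=> /= [] ik; congr (p.2 _ _); exact: val_inj.
Qed.

Lemma cons_rVK : cancel cons_rV uncons_rV.
Proof.
move=> p; rewrite /uncons_rV cons_rV0; case: p => x v /=; congr pair.
by apply/rowP => i; rewrite mxE cons_rV_lift.
Qed.

Lemma measurable_cons_rV : measurable_fun setT cons_rV.
Proof.
apply: measurable_to_rV => i; case: (unliftP ord0 i) => [j|] ->.
  under eq_fun do rewrite cons_rV_lift.
  exact: (measurableT_comp (measurable_coord j) measurable_snd).
under eq_fun do rewrite cons_rV0.
exact: measurable_fst.
Qed.

Lemma measurable_uncons_rV : measurable_fun setT uncons_rV.
Proof.
apply: measurable_fun_pair; first exact: measurable_coord.
apply: measurable_to_rV => i; rewrite /uncons_rV /=.
under eq_fun do rewrite mxE.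
exact: measurable_coord.
Qed.

Definition lebesgue_rV_step : set 'rV[R]_n.+1 -> \bar R :=
  pushforward (lebesgue_measure \x mu)%E cons_rV.

Let step0 : lebesgue_rV_step set0 = 0%E.
Proof. by rewrite /lebesgue_rV_step /pushforward preimage_set0 measure0. Qed.

Let step_ge0 A : (0 <= lebesgue_rV_step A)%E.
Proof. by rewrite /lebesgue_rV_step /pushforward measure_ge0. Qed.

Let step_sigma_additive : semi_sigma_additive lebesgue_rV_step.
Proof.
have mP A : measurable A -> measurable (cons_rV @^-1` A).
  by move=> mA; rewrite -[X in measurable X]setTI; exact: measurable_cons_rV.
move=> F mF tF mUF; rewrite /lebesgue_rV_step /pushforward preimage_bigcup.
apply: measure_semi_sigma_additive.
- by move=> i; exact: mP.
- apply/trivIsetP => /= i j _ _ ij; rewrite -preimage_setI.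
  by move/trivIsetP : tF => /(_ _ _ _ _ ij) ->//; rewrite preimage_set0.
- by rewrite -preimage_bigcup; exact: mP.
Qed.

HB.instance Definition _ := isMeasure.Build _ _ _ lebesgue_rV_step
  step0 step_ge0 step_sigma_additive.

Let step_sigma_finite : sigma_finite setT lebesgue_rV_step.
Proof.
have /sigma_finiteP[F [TF ndF Foo]] := sigma_finiteT (@lebesgue_measure R).
have /sigma_finiteP[G [TG ndG Goo]] := sigma_finiteT mu.
exists (fun i => uncons_rV @^-1` (F i `*` G i)).
  apply/esym; rewrite -subTset => v _ /=.
  have [i _ Fi] : (\bigcup_i F i) (uncons_rV v).1 by rewrite -TF.
  have [j _ Gj] : (\bigcup_i G i) (uncons_rV v).2 by rewrite -TG.
  exists (maxn i j) => //; split => /=.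
    by move: Fi; exact/subsetPset/ndF/leq_maxl.
  by move: Gj; exact/subsetPset/ndG/leq_maxr.
move=> i; have [mF Fi] := Foo i; have [mG Gi] := Goo i.
have mFG : measurable (F i `*` G i) by exact: measurableX.
split.
  by rewrite -[X in measurable X]setTI; exact: measurable_uncons_rV.
rewrite /lebesgue_rV_step /pushforward -comp_preimage.
rewrite (_ : uncons_rV \o cons_rV = idfun) ?preimage_id; last first.
  by apply/funext => p; exact: cons_rVK.
by rewrite product_measure1E// lte_mul_pinfty// ge0_fin_numE.
Qed.

HB.instance Definition _ := Measure_isSigmaFinite.Build _ _ _ lebesgue_rV_step
  step_sigma_finite.

End lebesgue_rV_step.

Fixpoint lebesgue_rV (R : realType) (n : nat) :
    {sigma_finite_measure set 'rV[R]_n -> \bar R} :=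
  match n with
  | 0 => [the {sigma_finite_measure set 'rV[R]_0 -> \bar R} of
           dirac (0 : 'rV[R]_0)]
  | n'.+1 => [the {sigma_finite_measure set 'rV[R]_n'.+1 -> \bar R} of
               lebesgue_rV_step (lebesgue_rV R n')]
  end.

Lemma lebesgue_rV_box (R : realType) n (A : 'I_n -> set (measurableTypeR R)) :
  (forall i, measurable (A i)) ->
  lebesgue_rV R n [set v | forall i, A i (v ord0 i)] =
  (\big[mule/1]_(i < n) lebesgue_measure (A i))%E.
Proof.
elim: n A => [|n IHn] A mA.
  rewrite big_ord0 /= diracE mem_set//; by case.
rewrite big_ord_recl /=.
rewrite -(IHn (fun i => A (lift ord0 i)))//.
pose B : set 'rV[R]_n := [set v | forall i, A (lift ord0 i) (v ord0 i)].
have mB : measurable B.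
  rewrite (_ : B = \big[setI/setT]_(i < n)
      ((fun v : 'rV[R]_n => v ord0 i) @^-1` A (lift ord0 i))).
    apply: bigsetI_measurable => i _.
    by rewrite -[X in measurable X]setTI; exact: measurable_coord.
  rewrite -bigcap_seq; apply/seteqP; split => v /= Bv i; first by move=> _; exact: Bv.
  by apply: Bv; rewrite /= mem_index_enum.
rewrite -product_measure1E//; congr (product_measure1 _ _ _).
apply/seteqP; split => [p /= Ap|p [/= A0 Ai] i].
  split => /=; first by have := Ap ord0; rewrite cons_rV0.
  by move=> i; have := Ap (lift ord0 i); rewrite cons_rV_lift.
by case: (unliftP ord0 i) => [j|] ->; rewrite ?cons_rV_lift ?cons_rV0.
Qed.

Section geometry.
Context (R : realType) (d : nat).
Local Notation E := 'rV[R]_d.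

Definition boundary (T : topologicalType) (A : set T) : set T :=
  closure A `\` A°.

Definition conv_hull (V : finType) (x : V -> E) (f : {set V}) : set E :=
  [set y | exists w : V -> R,
     [/\ forall i, 0 <= w i, forall i, i \notin f -> w i = 0,
         \sum_i w i = 1 & y = \sum_i w i *: x i]].

Definition affine_indep (V : finType) (x : V -> E) (f : {set V}) : Prop :=
  forall w : V -> R, (forall i, i \notin f -> w i = 0) ->
    \sum_i w i = 0 -> \sum_i w i *: x i = 0 -> forall i, w i = 0.

(* [(closure Omega)° = Omega] rules out slits: a domain lies locally on one
   side of its boundary faces. *)
Definition bounded_polyhedral_domain (Omega : set E) : Prop :=
  [/\ open Omega, connected Omega, Omega !=set0, bounded_set Omega &
      (closure Omega)° = Omega /\
      exists (k m : nat) (x : 'I_k -> 'I_m -> E),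
        closure Omega = \bigcup_i conv_hull (x i) [set: 'I_m]%SET].

(* Simplices are represented by their sets of vertices. *)
Record simplicial_mesh (Omega : set E) := SimplicialMesh {
  vertex : finType;
  node : vertex -> E;
  cells : {set {set vertex}};
  node_inj : injective node;
  vertex_in_cell : forall i : vertex, exists2 T, T \in cells & i \in T;
  card_cell : forall T, T \in cells -> #|T| = d.+1;
  cell_affine_indep : forall T, T \in cells -> affine_indep node T;
  (* two cells meet in a common subsimplex or, for [f = set0], not at all *)
  mesh_conforming : forall T T', T \in cells -> T' \in cells ->
    exists f : {set vertex}, [/\ f \subset T, f \subset T' &
      conv_hull node T `&` conv_hull node T' = conv_hull node f];
  mesh_cover : \bigcup_(T in [set` cells]) conv_hull node T = closure Omega
}.

End geometry.

Section mesh_spaces.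
Context (R : realType) (d : nat) (Omega : set 'rV[R]_d)
  (M : simplicial_mesh Omega).
Local Notation E := 'rV[R]_d.
Local Notation V := (vertex M).
Local Notation mu := (lebesgue_rV R d).

(* A simplex [f] of [Delta_m] has [#|f| = m.+1]. *)
Definition is_subsimplex (f : {set V}) : bool :=
  (f != finset.set0) && [exists T in cells M, f \subset T].

Definition Delta := {f : {set V} | is_subsimplex f}.

Definition hull (f : {set V}) : set E := conv_hull (@node _ _ _ M) f.

Definition macroelement (f : {set V}) : set E :=
  \bigcup_(T in [set T | T \in cells M /\ f \subset T]) hull T.

(* A function on Omega is represented by a function on R^d. Elements of
   [Pr M r] live on the closure of Omega, which is the union of the (closed)
   cells, and are extended by zero; elements of L^2 matter only up to
   a.e. equality on Omega. *)

Definition L2 (u : E -> R) : Prop := (u \_ Omega) \in Lfun mu 2%:E.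

Definition L2norm (u : E -> R) : R :=
  fine ('N[mu]_2%:E [EFin \o (u \_ Omega)])%E.

(* [mpoly.msize p] is the degree of [p] plus one. *)
Definition Pr (r : nat) : set (E -> R) :=
  [set u | [/\ {within closure Omega, continuous u},
     forall T, T \in cells M -> exists2 p : mpoly.mpoly d R,
       (mpoly.msize p <= r.+1)%N &
       forall x, hull T x -> u x = mpoly.meval (x ord0) p &
     forall x, ~ closure Omega x -> u x = 0]].

Definition hat (j : V) : E -> R :=
  xget (fun=> 0) [set l | Pr 1 l /\ forall i, l (node i) = (i == j)%:R].

(* With [n = m.+1], [corner_simplex n], [std_simplex n] and [Q_corner n r] are
   S_m^c, S_m and Q_r(S_m^c). *)
Definition corner_simplex (n : nat) : set 'rV[R]_n :=
  [set l | \sum_i l ord0 i <= 1 /\ forall i, 0 <= l ord0 i].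

Definition std_simplex (n : nat) : set 'rV[R]_n :=
  [set l | corner_simplex l /\ \sum_i l ord0 i = 1].

Definition Q_corner (n r : nat) : set (mpoly.mpoly n R) :=
  [set p | (mpoly.msize p <= r.+1)%N /\
     forall l, (boundary (@corner_simplex n) `\` @std_simplex n) l ->
       mpoly.meval (l ord0) p = 0].

Definition lambda (f : {set V}) (x : E) : 'I_#|f| -> R :=
  fun i => hat (enum_val i) x.

Definition Qstar (f : {set V}) (r : nat) : set (E -> R) :=
  if (#|f| <= d)%N then
    [set (fun x => mpoly.meval (lambda x) p) \_ (closure Omega)
      | p in @Q_corner #|f| r]
  else
    [set (fun x => mpoly.meval (x ord0) p) \_ (hull f)
      | p in [set p : mpoly.mpoly d R | (mpoly.msize p <= r.+1)%N /\
               forall x, boundary (hull f) x -> mpoly.meval (x ord0) p = 0]].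

Definition overlap_constant (a : R) : Prop :=
  forall u : Delta -> E -> R,
    (forall f, L2 (u f)) ->
    (forall f, u f = (fun=> 0) %[ae mu in Omega `\` macroelement (val f)]) ->
    a * L2norm (\sum_f u f) ^+ 2 <= \sum_f L2norm (u f) ^+ 2.

(* Operators on L^2(Omega), described on representatives: [bubble_stable] and
   [bubble_linear] make [B f u] depend only on the a.e. class of [u]. *)
Record bubble_transform (B : Delta -> (E -> R) -> E -> R) (b : R) : Prop := {
  bubble_L2 : forall f u, L2 u -> L2 (B f u);
  bubble_linear : forall f (c : R) u v, L2 u -> L2 v ->
    B f (c *: u + v) = c *: B f u + B f v %[ae mu in Omega];
  bubble_sum : forall u, L2 u -> \sum_f B f u = u %[ae mu in Omega];
  bubble_local : forall r f u, (0 < r)%N -> Pr r u ->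
    exists2 q, Qstar (val f) r q & B f u = q %[ae mu in Omega];
  bubble_stable : forall u, L2 u ->
    \sum_f L2norm (B f u) ^+ 2 <= b * L2norm u ^+ 2
}.

End mesh_spaces.

Section frames.
Context (R : realType) (H : lmodType R) (W : set H) (I : finType)
  (phi : I -> H).

Definition is_frame : Prop :=
  (forall k, W (phi k)) /\
  forall u, W u -> exists c : I -> R, u = \sum_k c k *: phi k.

Definition is_basis : Prop :=
  is_frame /\
  forall c : I -> R, \sum_k c k *: phi k = 0 -> forall k, c k = 0.

Definition min_coef (u : H) : R :=
  inf [set \sum_k c k ^+ 2 | c in [set c : I -> R | u = \sum_k c k *: phi k]].

Definition frame_ratios (norm : H -> R) : set \bar R :=
  [set (norm u ^+ 2 / min_coef u)%:E | u in [set u | W u /\ u <> 0]].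

(* The sup (beta) and inf (alpha) of the ratios are taken in [\bar R], where they
   always have their true value. *)
Definition condition_number (norm : H -> R) : \bar R :=
  (ereal_sup (frame_ratios norm) / ereal_inf (frame_ratios norm))%E.

End frames.

Definition union_family (J : Type) (N : J -> nat) (T : Type)
    (phi : forall j, 'I_(N j) -> T) (k : {j : J & 'I_(N j)}) : T :=
  phi (tag k) (tagged k).

(* Main.v *)
Require Import Defs.
From mathcomp Require Import all_boot all_order all_algebra.
From mathcomp Require Import all_classical all_reals all_analysis.
From mathcomp Require Import measurable_realfun.
From mathcomp.multinomials Require Import (canonicals, coercions) mpoly.
Import Order.TTheory GRing.Theory Num.Theory.
Import numFieldNormedType.Exports.
Local Open Scope classical_set_scope.
Local Open Scope ring_scope.

Set Implicit Arguments.
Unset Strict Implicit.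
Unset Printing Implicit Defensive.

(* If [u = \sum_(f, k) c_(f, k) phi_(f, k)], then the summands
   [u_f = \sum_k c_(f, k) phi_(f, k)] are supported in the macroelements, so the
   overlap bound gives [a |u|^2 <= \sum_f |u_f|^2 <= beta0 |c|^2]. Conversely, expanding each
   [B f u] in the basis of its space gives coefficients of [u] with
   [alpha0 |c|^2 <= \sum_f |B f u|^2 <= b |u|^2]. Two points need the geometry of the mesh.
   The hat functions exist because conformity makes barycentric coordinates independent of
   the cell, and this puts the local spaces inside [Pr]. The identity [u = \sum_f B f u], known
   only almost everywhere on Omega, is an equality of functions because members of [Pr] are
   continuous and nonempty open sets have positive Lebesgue measure. *)

(** * Lebesgue measure and square integrability on row vectors *)

Lemma measurable_box (R : realType) (n : nat) (A : 'I_n -> set (measurableTypeR R)) :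
  (forall i, measurable (A i)) ->
  measurable [set v : 'rV[R]_n | forall i, A i (v ord0 i)].
Proof.
move=> mA; rewrite (_ : [set _ | _] = \big[setI/setT]_(i < n)
    ((fun v : 'rV[R]_n => v ord0 i) @^-1` A i)).
  apply: bigsetI_measurable => i _.
  by rewrite -[X in measurable X]setTI; exact: measurable_coord.
rewrite -bigcap_seq; apply/seteqP; split => v /= Bv i; first by move=> _; exact: Bv.
by apply: Bv; rewrite /= mem_index_enum.
Qed.

Lemma ball_rVE (R : realType) (n : nat) (x : 'rV[R]_n) (e : R) : 0 < e ->
  ball x e = [set v : 'rV[R]_n | forall i, ball (x ord0 i) e (v ord0 i)].
Proof.
move=> e0; apply/seteqP; split => v /=; first by case=> _ h i; exact: (h ord0).
by move=> h; split => // i j; rewrite ord1.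
Qed.

Lemma lebesgue_measure_ballE (R : realType) (x e : R) : 0 < e ->
  lebesgue_measure (ball x e : set (measurableTypeR R)) = (e *+ 2)%:E.
Proof. by move=> e0; rewrite lebesgue_measure_ball// ltW. Qed.

Lemma measurable_ball_rV (R : realType) (n : nat) (x : 'rV[R]_n) (e : R) :
  0 < e -> measurable (ball x e).
Proof.
move=> e0; rewrite ball_rVE//.
apply: (@measurable_box _ _ (fun i => ball (x ord0 i) e)) => i.
by rewrite ball_itv; exact: measurable_itv.
Qed.

Lemma lebesgue_rV_ball (R : realType) (n : nat) (x : 'rV[R]_n) (e : R) :
  0 < e -> lebesgue_rV R n (ball x e) = ((e *+ 2) ^+ n)%:E.
Proof.
move=> e0; rewrite ball_rVE//.
rewrite (@lebesgue_rV_box _ _ (fun i => ball (x ord0 i) e)); last first.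
  by move=> i; rewrite ball_itv; exact: measurable_itv.
under eq_bigr do rewrite lebesgue_measure_ballE//.
by rewrite -(big_morph EFin (@EFinM R) (erefl _)) prodr_const card_ord.
Qed.

(** The sigma-algebra is generated by the coordinates, so an open set has to be written as a
    countable union of products: here of balls (cubes, for the sup norm) with rational centres and
    radii [1 / (k + 1)]. *)
Lemma open_measurable_rV (R : realType) (n : nat) (A : set 'rV[R]_n) :
  open A -> measurable A.
Proof.
move=> oA; pose c (p : 'rV[rat]_n) : 'rV[R]_n := map_mx ratr p.
(* A ball not contained in [A] is replaced by [set0], so that the index type is the countable type
   of all pairs. *)
pose F (p : 'rV[rat]_n * nat) : set 'rV[R]_n :=
  if `[< ball (c p.1) p.2.+1%:R^-1 `<=` A >] then ball (c p.1) p.2.+1%:R^-1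
  else set0.
rewrite (_ : A = \bigcup_p F p).
  apply: countable_bigcupT_measurable => // p; rewrite /F; case: ifP => // _.
  exact: measurable_ball_rV.
apply/seteqP; split => [x Ax|x [p _]]; last first.
  by rewrite /F; case: ifPn => // /asboolP; apply.
have [e /= e0 xeA] : exists2 e : R, 0 < e & ball x e `<=` A.
  by apply/nbhs_ballP; exact: open_nbhs_nbhs.
(* With this [N] the radius [1 / (N + 1)] is below [e / 2], so a ball of that radius containing [x]
   lies in [ball x e]. *)
pose N := Num.truncn (e^-1 *+ 2).
have N0 : (0 : R) < N.+1%:R^-1 by rewrite invr_gt0.
have Ne : N.+1%:R^-1 < e / 2.
  rewrite -[ltRHS]invrK ltf_pV2 ?posrE// ?invr_gt0 ?divr_gt0//.
  by rewrite invfM invrK mulr_natr; exact: truncnS_gt.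
have [p xp] : exists p : 'rV[rat]_n, ball (c p) N.+1%:R^-1 x.
  have h (i : 'I_n) : exists q : rat, ball (ratr q : R) N.+1%:R^-1 (x ord0 i).
    have : x ord0 i < x ord0 i + N.+1%:R^-1 by rewrite ltrDl.
    move=> /rat_in_itvoo[q]; rewrite in_itv/= => /andP[q1 q2]; exists q.
    by rewrite /ball/= gtr0_norm ?subr_gt0// ltrBlDl.
  have [q qE] := choice h; exists (\row_i q i).
  by rewrite ball_rVE// => i /=; rewrite !mxE.
exists (p, N) => //; rewrite /F/=; case: asboolP => // -[] y py.
apply: xeA; rewrite [e]splitr; apply: (ball_triangle (y := c p)).
  by apply: le_ball (ltW Ne) _ _; exact: ball_sym.
by apply: le_ball (ltW Ne) _ _.
Qed.

(** A nonempty open set contains a ball, whose measure [(2e)^n] is positive, also for [n = 0]. *)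
Lemma negligible_open_eq0 (R : realType) (n : nat) (U : set 'rV[R]_n) :
  open U -> (lebesgue_rV R n).-negligible U -> U = set0.
Proof.
move=> oU [Z [mZ Z0 UZ]]; rewrite -subset0 => x Ux.
have [e /= e0 xeU] : exists2 e : R, 0 < e & ball x e `<=` U.
  by apply/nbhs_ballP; exact: open_nbhs_nbhs.
have : (lebesgue_rV R n (ball x e) <= 0)%E.
  rewrite -Z0; apply: le_measure; rewrite ?inE//.
    exact: measurable_ball_rV.
  exact: subset_trans xeU UZ.
by rewrite lebesgue_rV_ball// lee_fin leNgt exprn_gt0// mulrn_wgt0.
Qed.

Lemma continuous_measurable_rV (R : realType) (n : nat) (U : set 'rV[R]_n)
    (u : 'rV[R]_n -> R) :
  open U -> {in U, continuous u} -> measurable_fun U u.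
Proof.
move=> oU cu; apply: (measurability _ (RGenOpens.measurableE R)).
move=> _ [_ [a [b ->] <-]]; apply: open_measurable_rV.
rewrite openE => x [Ux ux]; apply: filterI; first exact: open_nbhs_nbhs.
by apply: cu; [exact: mem_set|exact: open_nbhs_nbhs].
Qed.

Lemma lebesgue_rV_bounded_lty (R : realType) (n : nat) (U : set 'rV[R]_n) :
  measurable U -> bounded_set U -> (lebesgue_rV R n U < +oo)%E.
Proof.
(* [bounded_set] bounds the norm by every number above [M], here [|M| + 1]; the open ball needs a
   larger radius. *)
move=> mU [M [Mr UM]]; have e0 : 0 < `|M| + 2 by rewrite ltr_wpDl.
apply: (@le_lt_trans _ _ (lebesgue_rV R n (ball 0 (`|M| + 2)))).
  apply: le_measure; rewrite ?inE//; first exact: measurable_ball_rV.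
  move=> x Ux; rewrite -ball_normE /= sub0r normrN.
  have /(_ _ x Ux) xM := UM (`|M| + 1).
  apply: le_lt_trans (xM _) _; first by rewrite (le_lt_trans (ler_norm M))// ltrDl.
  by rewrite ltrD2l ltr1n.
by rewrite lebesgue_rV_ball// ltry.
Qed.

Lemma measurable_abse_poweR d (T : measurableType d) (R : realType)
    (v : T -> R) (r : R) :
  measurable_fun setT v -> measurable_fun setT (fun x => `|(v x)%:E| `^ r)%E.
Proof.
move=> mv; apply: (measurableT_comp (measurable_poweR _)).
by apply: measurableT_comp => //; exact/measurable_EFinP.
Qed.

(** The square of [u] is dominated by [|C|^2] on a set of finite measure. The absolute value is
    there because nothing fixes the sign of [C] when [U] is empty. *)
Lemma L2_bounded (R : realType) (n : nat) (U : set 'rV[R]_n) (u : 'rV[R]_n -> R)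
    (C : R) :
  open U -> bounded_set U -> {in U, continuous u} ->
  (forall x, U x -> `|u x| <= C) -> L2 U u.
Proof.
move=> oU bU cu uC.
have mU : measurable U by exact: open_measurable_rV.
have mu_ : measurable_fun setT (u \_ U).
  by apply/(measurable_restrictT _ mU); exact: continuous_measurable_rV.
rewrite /L2; apply/andP; split; first by rewrite inE.
rewrite inE /= /finite_norm unlock; apply: poweR_lty.
apply: (@le_lt_trans _ _ (\int[lebesgue_rV R n]_x
    ((fun=> (`|C| `^ 2)%:E) \_ U) x)%E).
  apply: ge0_le_integral => //.
  - by move=> x _; exact: poweR_ge0.
  - exact: measurable_abse_poweR.
  - by apply: (iffLR (measurable_restrictT _ mU)); exact: measurable_cst.
  - move=> x _; rewrite /= !patchE; case: ifPn => [|_].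
      rewrite inE => Ux; rewrite lee_fin ge0_ler_powR//.
      by rewrite (le_trans (uC _ Ux))// ler_norm.
    by rewrite normr0 powR0.
rewrite -integral_mkcond integral_cst//.
by rewrite lte_mul_pinfty// ?lee_fin ?powR_ge0// lebesgue_rV_bounded_lty.
Qed.

Lemma L2norm_ae_eq (R : realType) (n : nat) (U : set 'rV[R]_n)
    (u v : 'rV[R]_n -> R) :
  L2 U u -> L2 U v -> u = v %[ae lebesgue_rV R n in U] ->
  L2norm U u = L2norm U v.
Proof.
move=> /andP[+ _] /andP[+ _] uv; rewrite !inE/= => mu_ mv.
rewrite /L2norm unlock; congr (fine (_ `^ _)%E).
apply: ge0_ae_eq_integral => //.
- exact: measurable_abse_poweR.
- exact: measurable_abse_poweR.
- by move=> x _; exact: poweR_ge0.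
- by move=> x _; exact: poweR_ge0.
move: uv; apply: filterS => x uv _ /=; rewrite !patchE.
by case: ifPn => // /set_mem /uv ->.
Qed.

(** * Polynomials in several variables: continuity, degrees, the affine case *)

Lemma cvg_meval (R : realType) (T : Type) (F : set_system T) {FF : Filter F} (n : nat)
    (p : mpoly.mpoly n R) (g : T -> 'I_n -> R) (l : 'I_n -> R) :
  (forall i, g x i @[x --> F] --> l i) ->
  mpoly.meval (g x) p @[x --> F] --> mpoly.meval l p.
Proof.
move=> gl; rewrite mpoly.mevalE.
under eq_cvg do rewrite mpoly.mevalE.
apply: cvg_big => [|m _]; first exact: add_continuous.
apply: cvgM; first exact: cvg_cst.
apply: cvg_big => [|i _]; first exact: mul_continuous.
exact: (continuous_cvg _ (@exprn_continuous R _ _) (gl i)).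
Qed.

Lemma continuous_meval (R : realType) (n : nat) (p : mpoly.mpoly n R) :
  continuous (fun x : 'rV[R]_n => mpoly.meval (x ord0) p).
Proof.
move=> x; apply: (@cvg_meval R _ (nbhs x) _ n p (fun y => y ord0)) => i.
exact: coord_continuous.
Qed.

Lemma msize_sum_le (R : realType) (n k : nat) (I : Type) (s : seq I) (P : pred I)
    (F : I -> mpoly.mpoly n R) :
  (forall i, P i -> (mpoly.msize (F i) <= k)%N) ->
  (mpoly.msize (\sum_(i <- s | P i) F i)%R <= k)%N.
Proof.
move=> Fk; apply: leq_trans (mpoly.msize_sum _ _ _) _.
by elim/big_ind : _ => // x y xk yk; rewrite geq_max xk.
Qed.

(** [msize] is the degree plus one, but 0 for the zero polynomial. The successors turn the bound
    into additivity of degrees, and zero factors are treated apart. *)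
Lemma msizeM_leS (R : realType) (n k l : nat) (p q : mpoly.mpoly n R) :
  (mpoly.msize p <= k.+1)%N -> (mpoly.msize q <= l.+1)%N ->
  (mpoly.msize (p * q)%R <= (k + l).+1)%N.
Proof.
move=> pk ql; have [->|p0] := eqVneq p 0; first by rewrite mul0r mpoly.msize0.
have [->|q0] := eqVneq q 0; first by rewrite mulr0 mpoly.msize0.
by rewrite mpoly.msizeM// -subn1 leq_subLR add1n -addnS -addSn leq_add.
Qed.

(** A monomial of degree [m] becomes a product of [m] factors of degree at most one, so the degree
    does not grow. *)
Lemma msize_comp_affine (R : realType) (n m k : nat) (p : mpoly.mpoly n R)
    (lq : n.-tuple (mpoly.mpoly m R)) :
  (forall i, (mpoly.msize (tnth lq i) <= 2)%N) ->
  (mpoly.msize p <= k.+1)%N -> (mpoly.msize (mpoly.comp_mpoly lq p) <= k.+1)%N.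
Proof.
move=> lq2 pk; rewrite mpoly.comp_mpolyE big_seq; apply: msize_sum_le => e ep.
apply: leq_trans (mpoly.msizeZ_le _ _) _.
apply: leq_trans (leq_trans (mpoly.msize_mdeg_lt ep) pk).
rewrite mpoly.mdegE.
have h i : (mpoly.msize (tnth lq i ^+ e i)%R <= (e i).+1)%N.
  elim: (e i) => [|j ih]; first by rewrite expr0 mpoly.msize1.
  by rewrite exprS; apply: (@msizeM_leS _ _ 1).
elim/big_ind2 : _ => [|x y x' y' hx hy|i _]; first by rewrite mpoly.msize1.
- exact: msizeM_leS.
- exact: h.
Qed.

(** Only constants and single variables occur as monomials. A variable is linear in the point, and
    the constant term is reproduced because the weights sum to one. *)
Lemma meval_affine (R : realType) (n : nat) (I : finType) (p : mpoly.mpoly n R)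
    (w : I -> R) (x : I -> 'rV[R]_n) :
  (mpoly.msize p <= 2)%N -> \sum_i w i = 1 ->
  mpoly.meval ((\sum_i w i *: x i) ord0) p =
  \sum_i w i * mpoly.meval (x i ord0) p.
Proof.
move=> p2 w1; under [RHS]eq_bigr do rewrite mpoly.mevalE mulr_sumr.
rewrite mpoly.mevalE exchange_big /= big_seq [RHS]big_seq; apply: eq_bigr => e ep.
under [RHS]eq_bigr do rewrite mulrCA.
rewrite -mulr_sumr; congr (_ * _).
have := leq_trans (mpoly.msize_mdeg_lt ep) p2.
rewrite ltnS leq_eqVlt ltnS leqn0 mpoly.mdeg_eq0.
move=> /orP[/mpoly.mdeg1P[j /eqP ->]|/eqP ->].
  have E y : \prod_i (y i : R) ^+ (mpoly.mnm1 j : mpoly.multinom n) i = y j.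
    by rewrite (bigD1 j)//= big1 ?mulr1 ?mpoly.mnm1E ?eqxx ?expr1// => i ij;
      rewrite mpoly.mnm1E eq_sym (negPf ij) expr0.
  rewrite E summxE; apply: eq_bigr => i _; by rewrite E mxE.
have E (y : 'I_n -> R) : \prod_i (y i : R) ^+ (mpoly.mnm0 : mpoly.multinom n) i = 1.
  by rewrite big1// => i _; rewrite mpoly.mnm0E expr0.
by rewrite E -[LHS]w1; apply: eq_bigr => i _; rewrite E mulr1.
Qed.

Lemma affine_mpolyP (R : realType) (n : nat) (c : R) (a : 'I_n -> R) :
  exists2 p : mpoly.mpoly n R, (mpoly.msize p <= 2)%N &
    forall y, mpoly.meval y p = c + \sum_j a j * y j.
Proof.
exists (mpoly.mpolyC n c + \sum_j a j *: mpoly.mpolyX R (mpoly.mnm1 j))%R.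
  apply: leq_trans (mpoly.msizeD_le _ _) _; rewrite geq_max.
  apply/andP; split; first by rewrite mpoly.msizeC; case: (c != 0).
  apply: msize_sum_le => j _; apply: leq_trans (mpoly.msizeZ_le _ _) _.
  by rewrite mpoly.msizeX mpoly.mdeg1.
move=> y; rewrite mpoly.mevalD mpoly.mevalC raddf_sum; congr (_ + _).
by apply: eq_bigr => j _; rewrite /= mpoly.mevalZ mpoly.mevalXU.
Qed.

(** * Barycentric coordinates of one simplex *)

Lemma affine_indep_inj (R : realType) (d : nat) (V : finType) (x : V -> 'rV[R]_d)
    (T : {set V}) (w w' : V -> R) :
  affine_indep x T ->
  (forall i, i \notin T -> w i = 0) -> (forall i, i \notin T -> w' i = 0) ->
  \sum_i w i = \sum_i w' i -> \sum_i w i *: x i = \sum_i w' i *: x i -> w = w'.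
Proof.
move=> aT wT w'T s1 s2; apply/funext => i; apply/eqP; rewrite -subr_eq0; apply/eqP.
apply: (aT (fun i => w i - w' i)) => [j jT||].
- by rewrite wT// w'T// subrr.
- by rewrite sumrB s1 subrr.
- under eq_bigr do rewrite scalerBl.
  by rewrite sumrB s2 subrr.
Qed.

(** Prefixing each vertex of [T] with a coordinate 1 gives the rows of a matrix [A], square since
    [T] has [d.+1] elements and invertible by affine independence. The barycentric coordinates of
    [y] are the entries of [(1, y)] times the inverse of [A], hence affine in [y]. *)
Lemma barycentric_poly (R : realType) (d : nat) (V : finType) (x : V -> 'rV[R]_d)
    (T : {set V}) :
  affine_indep x T -> #|T| = d.+1 ->
  exists p : V -> mpoly.mpoly d R,
    [/\ forall i, (mpoly.msize (p i) <= 2)%N,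
        forall i y, i \notin T -> mpoly.meval y (p i) = 0,
        forall y, \sum_i mpoly.meval y (p i) = 1 &
        forall y : 'rV[R]_d, \sum_i mpoly.meval (y ord0) (p i) *: x i = y].
Proof.
move=> aT cT.
pose lift1 (y : 'rV[R]_d) : 'rV[R]_(1 + d) := row_mx (const_mx 1) y.
pose A : 'M[R]_(#|T|, 1 + d) := \matrix_k lift1 (x (enum_val k)).
(* [coef] carries a vector indexed by the enumeration of [T] to a function on all of [V]. *)
pose coef (v : 'rV[R]_#|T|) i := \sum_(k | enum_val k == i) v ord0 k.
have coefE (W : lmodType R) (v : 'rV[R]_#|T|) (g : V -> W) :
    \sum_i coef v i *: g i = \sum_k v ord0 k *: g (enum_val k).
  rewrite [RHS](partition_big enum_val predT)//=; apply: eq_bigr => i _.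
  by rewrite scaler_suml; apply: eq_bigr => k /eqP ->.
have coef_out v i : i \notin T -> coef v i = 0.
  by move=> iT; apply: big_pred0 => k; apply: contraNF iT => /eqP <-; exact: enum_valP.
have mulA v : v *m A = \sum_i coef v i *: lift1 (x i).
  by rewrite coefE mulmx_sum_row; apply: eq_bigr => k _; rewrite rowK.
have mulAr v : rsubmx (v *m A) = \sum_i coef v i *: x i.
  rewrite mulA linear_sum; apply: eq_bigr => i _.
  by rewrite linearZ/= row_mxKr.
have mulAl v : lsubmx (v *m A) ord0 ord0 = \sum_i coef v i.
  rewrite mulA linear_sum summxE; apply: eq_bigr => i _.
  by rewrite linearZ/= row_mxKl !mxE mulr1.
have freeA : row_free A.
  apply: inj_row_free => v vA0; apply/rowP => k.
  have /(_ (enum_val k)) : forall i, coef v i = 0.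
    apply: aT; first exact: coef_out.
      by rewrite -mulAl vA0 !mxE.
    by rewrite -mulAr vA0; apply/rowP => j; rewrite !mxE.
  rewrite /coef (eq_bigl (pred1 k)) ?big_pred1_eq ?mxE// => j.
  exact: inj_eq enum_val_inj _ _.
have fullA : row_full A by rewrite /row_full (eqP freeA) cT.
pose P := pinvmx A.
(* The row of [P] that meets the prefixed 1 gives the constant terms, the other rows give the
   slopes. *)
pose c i := \sum_(k | enum_val k == i) P (lshift d ord0) k.
pose a i (j : 'I_d) := \sum_(k | enum_val k == i) P (rshift 1 j) k.
pose u y := lift1 y *m P.
have uA y : u y *m A = lift1 y by rewrite mulmxKpV// submx_full.
have uE y i : coef (u y) i = c i + \sum_j a i j * y ord0 j.
  rewrite /coef /c /a; under [X in _ + X]eq_bigr do rewrite mulr_suml.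
  rewrite exchange_big -big_split/=; apply: eq_bigr => k _.
  rewrite mxE big_split_ord/= big_ord1 row_mxEl mxE mul1r; congr (_ + _).
  by apply: eq_bigr => j _; rewrite row_mxEr mulrC.
have /choice[p pP] i : exists p : mpoly.mpoly d R, (mpoly.msize p <= 2)%N /\
    forall y, mpoly.meval y p = c i + \sum_j a i j * y j.
  by have [p] := affine_mpolyP (c i) (a i); exists p.
have pE (y : 'I_d -> R) i : mpoly.meval y (p i) = coef (u (\row_j y j)) i.
  by rewrite (pP i).2 uE; congr (_ + _); apply: eq_bigr => j _; rewrite mxE.
have yE (y : 'rV[R]_d) : \row_j y ord0 j = y by apply/rowP => j; rewrite mxE.
exists p; split => [i|i y iT|y|y]; first exact: (pP i).1.
- by rewrite pE coef_out.
- under eq_bigr do rewrite pE.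
  by rewrite -mulAl uA row_mxKl mxE.
- under eq_bigr do rewrite pE yE.
  by rewrite -mulAr uA row_mxKr.
Qed.

Lemma barycentric_unique (R : realType) (d : nat) (V : finType)
    (x : V -> 'rV[R]_d) (T : {set V}) (p : V -> mpoly.mpoly d R) :
  affine_indep x T ->
  [/\ forall i, (mpoly.msize (p i) <= 2)%N,
      forall i y, i \notin T -> mpoly.meval y (p i) = 0,
      forall y, \sum_i mpoly.meval y (p i) = 1 &
      forall y : 'rV[R]_d, \sum_i mpoly.meval (y ord0) (p i) *: x i = y] ->
  forall w : V -> R, (forall i, i \notin T -> w i = 0) -> \sum_i w i = 1 ->
  forall i, mpoly.meval ((\sum_j w j *: x j) ord0) (p i) = w i.
Proof.
move=> aT [_ pT p1 px] w wT w1 i; set y := \sum_j _.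
suff : (fun i => mpoly.meval (y ord0) (p i)) = w by move/(congr1 (@^~ i)).
by apply: (affine_indep_inj aT); rewrite ?p1 ?px// => j; exact: pT.
Qed.

(** The simplex is cut out by the nonnegativity of its barycentric polynomials, finitely many closed
    conditions. *)
Lemma closed_conv_hull (R : realType) (d : nat) (V : finType) (x : V -> 'rV[R]_d)
    (T : {set V}) :
  affine_indep x T -> #|T| = d.+1 -> closed (conv_hull x T).
Proof.
move=> aT cT; have [p pP] := barycentric_poly aT cT.
have pU := barycentric_unique aT pP.
rewrite (_ : conv_hull x T = \bigcap_i
   ((fun y => mpoly.meval (y ord0) (p i)) @^-1` [set z | 0 <= z])).
  apply: closed_bigI => i _; apply: preimage_closed; last exact: closed_ge.
  by move=> y _; exact: continuous_meval.
case: pP => _ pT p1 px.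
apply/seteqP; split => [_ [w [w0 wT w1 ->]] i _ /=| y yp]; first by rewrite pU.
exists (fun i => mpoly.meval (y ord0) (p i)); split => [i|i iT||].
- exact: yp.
- exact: pT.
- exact: p1.
- by rewrite px.
Qed.

(** * Barycentric weights across the mesh, and the hat functions *)

Section mesh.
Context (R : realType) (d : nat) (Omega : set 'rV[R]_d)
  (M : simplicial_mesh Omega).
Local Notation V := (vertex M).
Implicit Types (T f : {set V}) (w : V -> R) (x : 'rV[R]_d) (u v : 'rV[R]_d -> R).

(** The weights that witness membership in a hull, indexed by all vertices of the mesh so that those
    taken in different cells can be compared. *)
Definition convex_coords T x w :=
  [/\ forall i, 0 <= w i, forall i, i \notin T -> w i = 0,
      \sum_i w i = 1 & x = \sum_i w i *: node i].

Lemma convex_coords_node T i :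
  i \in T -> convex_coords T (node i) (fun k => (k == i)%:R).
Proof.
move=> iT; split => [k|k kT||].
- exact: ler0n.
- by case: eqP kT => // ->; rewrite iT.
- by rewrite (bigD1 i)//= big1 ?eqxx ?addr0// => k /negPf ->.
- by rewrite (bigD1 i)//= big1 ?eqxx ?scale1r ?addr0// => k /negPf ->; rewrite scale0r.
Qed.

(** By conformity [x] lies in the hull of a common subsimplex. Weights taken there serve for both
    cells, and in each cell weights are unique by affine independence. *)
Lemma convex_coords_unique T T' x w w' : T \in cells M -> T' \in cells M ->
  convex_coords T x w -> convex_coords T' x w' -> w = w'.
Proof.
move=> cT cT' [w0 wT w1 xw] [w0' wT' w1' xw'].
have [g [gT gT' TT']] := mesh_conforming cT cT'.
have [z [z0 zg z1 xz]] : conv_hull (@node _ _ _ M) g x.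
  by rewrite -TT'; split; [exists w|exists w'].
have -> : w = z.
  apply: (affine_indep_inj (cell_affine_indep cT)); rewrite ?w1 -?xw// => i iT.
  by apply: zg; apply: contra iT => /(fintype.subsetP gT).
apply: (affine_indep_inj (cell_affine_indep cT')); rewrite ?w1' ?z1 -?xw' -?xz// => i iT.
by apply: zg; apply: contra iT => /(fintype.subsetP gT').
Qed.

Lemma convex_coords_mpoly T : T \in cells M -> exists p : V -> mpoly.mpoly d R,
  (forall i, (mpoly.msize (p i) <= 2)%N) /\
  forall x w, convex_coords T x w -> forall i, mpoly.meval (x ord0) (p i) = w i.
Proof.
move=> cT; have aT := cell_affine_indep cT.
have [p pP] := barycentric_poly aT (card_cell cT).
exists p; split=> [|x w [w0 wT w1 ->] i]; first by case: pP.
exact: (barycentric_unique aT pP).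
Qed.

Lemma closure_cell x : closure Omega x -> exists2 T, T \in cells M & hull T x.
Proof. by rewrite -(mesh_cover M) => -[T cT hx]; exists T. Qed.

Lemma cell_closure T : T \in cells M -> hull T `<=` closure Omega.
Proof. by move=> cT x hx; rewrite -(mesh_cover M); exists T. Qed.

Lemma closed_hull T : T \in cells M -> closed (hull T).
Proof.
move=> cT; apply: closed_conv_hull; [exact: cell_affine_indep|exact: card_cell].
Qed.

(** Pasting over the finitely many cells, which are closed. *)
Lemma within_closure_continuous u :
  (forall T, T \in cells M -> {within hull T, continuous u}) ->
  {within closure Omega, continuous u}.
Proof.
move=> cu.
have -> : closure Omega = \big[setU/set0]_(T <- enum (cells M)) hull T.
  by rewrite -(mesh_cover M) -bigcup_seq; apply: eq_bigcupl;
    split => T /=; rewrite mem_enum.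
have : forall T, T \in enum (cells M) -> T \in cells M by move=> T; rewrite mem_enum.
elim: (enum _) => [_|T s ih sM].
  by rewrite big_nil; exact: continuous_subspace0.
rewrite big_cons; apply: withinU_continuous.
- by apply/closed_hull/sM; rewrite mem_head.
- by apply: closed_bigsetU => T' T's; apply/closed_hull/sM; rewrite inE T's orbT.
- by apply/cu/sM; rewrite mem_head.
- by apply: ih => T' T's; apply: sM; rewrite inE T's orbT.
Qed.

(** Continuity comes for free: the polynomials on closed cells are restrictions of one function, so
    they agree on overlaps. *)
Lemma piecewise_poly_Pr r u :
  (forall x, ~ closure Omega x -> u x = 0) ->
  (forall T, T \in cells M -> exists2 p : mpoly.mpoly d R,
     (mpoly.msize p <= r.+1)%N & forall x, hull T x -> u x = mpoly.meval (x ord0) p) ->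
  Pr M r u.
Proof.
move=> u0 up; split => //; apply: within_closure_continuous => T cT.
have [p _ pE] := up _ cT.
apply: (@subspace_eq_continuous _ _ _
    (fun x : subspace (hull T) => mpoly.meval ((x : 'rV[R]_d) ord0) p)).
  by move=> x /set_mem/pE.
by apply: continuous_subspaceT; exact: continuous_meval.
Qed.

(** The value at [x] is the weight of [j] in any cell containing [x]; by [convex_coords_unique] the
    choice of the cell does not matter. *)
Lemma hat_exists (j : V) : exists l, Pr M 1 l /\ forall i, l (node i) = (i == j)%:R.
Proof.
pose P x := [set w | exists2 T, T \in cells M & convex_coords T x w].
(* Off the closure of [Omega] the set [P x] is empty, and the default value gives the extension by
   zero. *)
pose l x := xget (fun=> 0) (P x) j.
have lE T x w : T \in cells M -> convex_coords T x w -> l x = w j.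
  move=> cT Txw; rewrite /l.
  case: xgetP => [z _ [T' cT' T'xz]|/(_ w)[]]; last by exists T.
  by rewrite (convex_coords_unique cT cT' Txw T'xz).
exists l; split.
  apply: piecewise_poly_Pr => [x xO|T cT].
    rewrite /l; case: xgetP => // w _ [T cT xw]; exfalso; apply: xO.
    by apply: (cell_closure cT); exists w.
  have [p [p2 pE]] := convex_coords_mpoly cT; exists (p j) => // x [w xw].
  by rewrite (lE T _ w)// (pE _ w).
move=> i; have [T cT iT] := vertex_in_cell i.
rewrite (lE T _ (fun k => (k == i)%:R))// ?[j == i]eq_sym//.
exact: convex_coords_node.
Qed.

Lemma hatP (j : V) : Pr M 1 (hat j) /\ forall i, hat j (node i) = (i == j)%:R.
Proof. exact: (xgetPex (fun=> 0) (hat_exists j)). Qed.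

(** [hat] is defined by a choice, but on a cell it is a polynomial of degree at most one, hence
    determined by its values at the vertices. *)
Lemma hatE T x w j : T \in cells M -> convex_coords T x w -> hat j x = w j.
Proof.
move=> cT xw; have [[_ + _] hn] := hatP j; move=> /(_ T cT)[p p2 pE].
have nT i : i \in T -> hull T (node i).
  by move=> iT; exists (fun k => (k == i)%:R); exact: convex_coords_node.
rewrite pE; last by exists w.
case: xw => w0 wT w1 ->; rewrite meval_affine// (bigD1 j)//= big1 => [|i ij].
  have [jT|jT] := boolP (j \in T); last by rewrite wT// mul0r addr0.
  by rewrite -pE ?hn ?eqxx ?mulr1 ?addr0//; exact: nT.
have [iT|iT] := boolP (i \in T); last by rewrite wT// mul0r.
by rewrite -pE ?hn ?(negPf ij) ?mulr0//; exact: nT.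
Qed.

End mesh.

(** * Faces of the corner simplex and vanishing on them *)

Lemma cvg_dir (R : realType) (n : nat) (x v : 'rV[R]_n) :
  x + t *: v @[t --> 0^'+] --> x.
Proof.
apply: cvg_at_right_filter; rewrite -[X in _ --> X]addr0 -(scale0r v).
by apply: cvgD; [exact: cvg_cst|apply: cvgZr_tmp; exact: cvg_id].
Qed.

(** Used in contrapositive form: a direction in which every positive step leaves the set excludes an
    interior point. *)
Lemma interior_dir (R : realType) (n : nat) (A : set 'rV[R]_n) (x v : 'rV[R]_n) :
  A° x -> exists2 t, 0 < t & A (x + t *: v).
Proof.
move=> Ax; have /(_ _ Ax) At := @cvg_dir _ _ x v.
have [t [t0 ?]] : exists t, 0 < t /\ A (x + t *: v).
  apply: (@filter_ex _ _ (at_right_proper_filter 0)).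
  by apply: filterI => //; exact: nbhs_right_gt.
by exists t.
Qed.

Lemma meval_dir_eq0 (R : realType) (n : nat) (p : mpoly.mpoly n R) (x v : 'rV[R]_n) :
  (forall t, 0 < t -> t < 1 -> mpoly.meval ((x + t *: v) ord0) p = 0) ->
  mpoly.meval (x ord0) p = 0.
Proof.
move=> p0; apply: (@cvg_unique R (@Rhausdorff R)
    (mpoly.meval ((x + t *: v) ord0) p @[t --> 0^'+])).
  exact: (cvg_comp _ _ (@cvg_dir _ _ x v) (@continuous_meval _ _ p x)).
apply: (cvg_trans (near_eq_cvg _) (cvg_cst (0 : R))); near=> t.
apply/esym; apply: p0; near: t; [exact: nbhs_right_gt|exact: nbhs_right_lt].
Unshelve. all: by end_near. Qed.

Lemma corner_face_boundary (R : realType) (n : nat) (l : 'rV[R]_n) (i : 'I_n) :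
  corner_simplex l -> l ord0 i = 0 -> boundary (@corner_simplex R n) l.
Proof.
move=> cl li0; split; first exact: subset_closure.
(* Any positive step in this direction makes the coordinate [i] negative. *)
move=> /(interior_dir (- delta_mx ord0 i))[t t0 [_ /(_ i)]].
by rewrite !mxE li0 !eqxx add0r mulrN mulr1 oppr_ge0 leNgt t0.
Qed.

Lemma Q_corner_face (R : realType) (n r : nat) (p : mpoly.mpoly n R)
    (l : 'rV[R]_n) (i : 'I_n) :
  Q_corner r p -> corner_simplex l -> l ord0 i = 0 -> mpoly.meval (l ord0) p = 0.
Proof.
move=> [_ p0] [l1 l0] li0.
(* points of the face that lie in [std_simplex] are limits of others *)
apply: (@meval_dir_eq0 _ _ _ _ (- l)) => t t0 t1.
(* Scaling towards the origin keeps the zero coordinate and brings the sum below 1. *)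
have E : l + t *: - l = (1 - t) *: l by rewrite scalerN scalerBl scale1r.
have sE : \sum_j ((1 - t) *: l) ord0 j = (1 - t) * \sum_j l ord0 j.
  by rewrite mulr_sumr; apply: eq_bigr => j _; rewrite mxE.
have lt1 : (1 - t) * \sum_j l ord0 j < 1.
  apply: (@le_lt_trans _ _ (1 - t)); last by rewrite ltrBlDr ltrDl.
  by rewrite ler_piMr// subr_ge0 ltW.
rewrite E; apply: p0; split.
  apply: (@corner_face_boundary _ _ _ i); last by rewrite mxE li0 mulr0.
  split; first by rewrite sE ltW.
  by move=> j; rewrite mxE mulr_ge0// subr_ge0 ltW.
by move=> [_]; rewrite sE => /eqP; rewrite lt_eqF.
Qed.

(** * Support and piecewise polynomial form of the local spaces *)

Section mesh_Qstar.
Context (R : realType) (d : nat) (Omega : set 'rV[R]_d)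
  (M : simplicial_mesh Omega).
Local Notation V := (vertex M).
Implicit Types (T f : {set V}) (w : V -> R) (x : 'rV[R]_d) (u v : 'rV[R]_d -> R).

(** A step of length [t] along [x - node i], away from the opposite vertex, turns the weight of [i]
    from 0 into [-t], so the cell is left at once. *)
Lemma face_boundary T x w i : T \in cells M -> i \in T ->
  convex_coords T x w -> w i = 0 -> boundary (hull T) x.
Proof.
move=> cT iT [w0 wT w1 xw] wi0; split; first by apply: subset_closure; exists w.
move=> /(interior_dir (x - node i))[t t0 [w' [w0' wT' w1' yw']]].
pose e k : R := (k == i)%:R.
have [_ eT e1 eE] := convex_coords_node iT.
have ww' : (fun k => w k + t * (w k - e k)) = w'.
  apply: (affine_indep_inj (cell_affine_indep cT)) => // [k kT||].
  - by rewrite wT// /e eT// subrr mulr0 addr0.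
  - by rewrite big_split/= -mulr_sumr sumrB w1 e1 w1' subrr mulr0 addr0.
  - rewrite -yw' {1 2}xw {1}eE scalerBr !scaler_sumr -sumrB -big_split/=.
    by apply: eq_bigr => k _; rewrite scalerDl mulrBr scalerBl !scalerA.
have := w0' i; rewrite -ww' /e eqxx wi0 add0r sub0r mulrN1 oppr_ge0 leNgt.
by rewrite t0.
Qed.

Lemma lambda_corner T x w f : T \in cells M -> convex_coords T x w ->
  corner_simplex (\row_k lambda (f := f) x k).
Proof.
move=> cT xw; have [w0 _ w1 _] := xw; split => [|k].
  under eq_bigr do rewrite mxE /lambda (hatE _ cT xw).
  rewrite -[leRHS]w1 -(big_enum_val (fun i => w i)) [leRHS](bigID (mem f))/=.
  by rewrite lerDl sumr_ge0.
by rewrite mxE /lambda (hatE _ cT xw).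
Qed.

Lemma subsimplex_cell f : is_subsimplex f -> (d < #|f|)%N -> f \in cells M.
Proof.
case/andP => _ /existsP[T /andP[cT fT]] df; suff -> : f = T by [].
by apply/eqP; rewrite eqEcard fT (card_cell cT).
Qed.

(** If a cell containing [x] lacks a vertex of [f], the hat function of that vertex is zero at [x].
    Then [lambda x] lies on a coordinate face of the corner simplex, where [Q_corner_face]
    applies. *)
Lemma Qstar_eq0 f r q x : is_subsimplex f -> Qstar f r q ->
  ~ macroelement f x -> q x = 0.
Proof.
rewrite /Qstar => f0; case: ifPn => [fd [p pQ <-]|fd [p _ <-]] xf; rewrite patchE.
  case: ifPn => // /set_mem/(closure_cell M)[T cT [w xw]].
  have /subsetPn[i fi iT] : ~~ (f \subset T).
    by apply/negP => fT; apply: xf; exists T => //; exists w.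
  rewrite (_ : lambda x = (\row_k lambda (f := f) x k) ord0); last first.
    by apply/funext => k; rewrite mxE.
  have := @Q_corner_face _ _ r p (\row_k lambda (f := f) x k) (enum_rank_in fi i) pQ
    (lambda_corner f cT xw).
  apply; rewrite mxE /lambda enum_rankK_in// (hatE _ cT xw); by case: xw => _ ->.
case: ifPn => // /set_mem xh; exfalso; apply: xf; exists f => //; split => //.
by apply: subsimplex_cell; rewrite // ltnNge.
Qed.

(** If [f] is not a cell, the element is, on each cell, [p] composed with barycentric polynomials of
    degree at most one. If [f] is a cell, the extension by zero is consistent because other cells
    meet [f] only in its boundary. *)
Lemma Qstar_Pr f r q : is_subsimplex f -> Qstar f r q -> Pr M r q.
Proof.
rewrite /Qstar => ff; case: ifPn => [fd [p [pr _] <-]|fd [p [pr p0] <-]].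
  apply: piecewise_poly_Pr => [x xO|T cT]; first by rewrite patchE memNset.
  have [b [b2 bE]] := convex_coords_mpoly cT.
  exists (mpoly.comp_mpoly [tuple b (enum_val k) | k < #|f|] p).
    by apply: msize_comp_affine => // k; rewrite tnth_mktuple.
  move=> x xT; have xO := cell_closure cT xT; rewrite patchE mem_set//.
  rewrite mpoly.comp_mpoly_meval; congr (mpoly.meval _ _); apply/funext => k.
  by have [w xw] := xT; rewrite tnth_mktuple (bE _ _ xw) /lambda (hatE _ cT xw).
have cf : f \in cells M by apply: subsimplex_cell; rewrite // ltnNge.
apply: piecewise_poly_Pr => [x xO|T cT].
  by rewrite patchE; case: ifPn => // /set_mem/(cell_closure cf)/xO.
have [->|Tf] := eqVneq T f; first by exists p => // x xf; rewrite patchE mem_set.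
exists 0 => [|x xT]; first by rewrite mpoly.msize0.
rewrite raddf0 patchE; case: ifPn => // /set_mem xf; apply: p0.
(* Such a vertex has weight zero at every common point of the two cells. *)
have [i fi iT] : exists2 i, i \in f & i \notin T.
  apply/subsetPn; apply: contra Tf => fT.
  by rewrite eq_sym eqEcard fT (card_cell cT) (card_cell cf) leqnn.
have [w xw] := xf; have [w' xw'] := xT.
apply: (face_boundary cf fi xw).
by rewrite (convex_coords_unique cf cT xw xw'); case: xw' => _ ->.
Qed.

End mesh_Qstar.

(** * Linear combinations, integrability and almost everywhere equality in [Pr] *)

Section mesh_Pr.
Context (R : realType) (d : nat) (Omega : set 'rV[R]_d)
  (M : simplicial_mesh Omega).
Implicit Types (u v : 'rV[R]_d -> R).

Lemma Pr_sumZ r (I : finType) (c : I -> R) (F : I -> 'rV[R]_d -> R) :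
  (forall i, Pr M r (F i)) -> Pr M r (\sum_i c i *: F i).
Proof.
move=> PF; apply: piecewise_poly_Pr => [x xO|T cT].
  by rewrite fct_sumE big1// => i _; have [_ _ /(_ x xO) F0] := PF i;
    rewrite scalrfctE F0 scaler0.
have /choice[p pP] i : exists p : mpoly.mpoly d R, (mpoly.msize p <= r.+1)%N /\
    forall x, hull T x -> F i x = mpoly.meval (x ord0) p.
  by have [_ /(_ _ cT)[p ? ?] _] := PF i; exists p.
exists (\sum_i c i *: p i).
  apply: msize_sum_le => i _; apply: leq_trans (mpoly.msizeZ_le _ _) _.
  exact: (pP i).1.
move=> x xT; rewrite fct_sumE raddf_sum; apply: eq_bigr => i _.
by rewrite /= scalrfctE (pP i).2// mpoly.mevalZ.
Qed.

Lemma Pr_continuous r u : open Omega -> Pr M r u -> {in Omega, continuous u}.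
Proof.
move=> oO [cu _ _]; rewrite -continuous_open_subspace//.
exact: continuous_subspaceW (@subset_closure _ _) cu.
Qed.

(** Continuity on the compact closure of [Omega] bounds [u]. *)
Lemma Pr_L2 r u : open Omega -> bounded_set Omega -> Pr M r u -> L2 Omega u.
Proof.
move=> oO bO Pu; have [cu _ _] := Pu.
have cO : compact (closure Omega).
  apply: bounded_closed_compact; last exact: closed_closure.
  have [N [Nr ON]] := bO; exists N; split => // y Ny.
  (* [D] is closed, so the norm bound on [Omega] passes to the closure. *)
  pose D : set 'rV[R]_d := (fun x => `|x|) @^-1` [set z | z <= y].
  have /closure_id cD : closed D.
    by apply: preimage_closed => [x _|]; [exact: norm_continuous|exact: closed_le].
  suff : closure Omega `<=` D by [].
  by rewrite cD; apply: closure_subset => x; exact: ON.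
have [N [Nr uN]] := compact_bounded (continuous_compact cu cO).
apply: (@L2_bounded _ _ _ _ (N + 1)) => //; first exact: Pr_continuous Pu.
move=> x Ox; apply: (uN (N + 1)); first by rewrite ltrDl.
by exists x => //; exact: subset_closure.
Qed.

(** The points of [Omega] where the functions differ form a negligible open set, hence none exist.
    Equality passes to the closure by limits, and outside both functions are zero. *)
Lemma Pr_ae_eq r u v : open Omega -> Pr M r u -> Pr M r v ->
  u = v %[ae lebesgue_rV R d in Omega] -> u = v.
Proof.
move=> oO Pu Pv uv.
have cu := Pr_continuous oO Pu; have cv := Pr_continuous oO Pv.
have uvO x : Omega x -> u x = v x.
  move=> Ox; apply/eqP/negPn/negP => /eqP uvx.
  pose U := [set x | Omega x /\ u x != v x].
  suff : U = set0 by rewrite -subset0 => /(_ x); apply; split => //; apply/eqP.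
  apply: negligible_open_eq0.
    rewrite openE => y [Oy uvy].
    have /(_ [set z | z != 0]) : u z - v z @[z --> y] --> u y - v y.
      exact: cvgB (cu y (mem_set Oy)) (cv y (mem_set Oy)).
    rewrite /= => h; have {}h : \forall z \near y, u z - v z != 0.
      by apply: h; apply: open_nbhs_nbhs; split; [exact: open_neq|rewrite /= subr_eq0].
    apply: filterI; first exact: open_nbhs_nbhs.
    by apply: filterS h => z; rewrite /= subr_eq0.
  apply: negligibleS uv => y [Oy /eqP uvy] /= /(_ Oy).
  exact: uvy.
apply/funext => x; have [xO|xO] := pselect (closure Omega x); last first.
  by have [_ _ u0] := Pu; have [_ _ v0] := Pv; rewrite u0// v0.
(* At a point of the closure, limits from within [Omega] are taken along a proper filter, hence
   unique. *)
have FF := within_nbhs_proper xO.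
have lim z : Pr M r z -> z @ within Omega (nbhs x) --> z x.
  move=> [/subspace_continuousP/(_ x xO) cz _ _]; apply: cvg_trans cz.
  by apply: cvg_app; apply: within_subset; exact: subset_closure.
apply: (@cvg_unique R (@Rhausdorff R) (u @ within Omega (nbhs x))).
  exact: lim.
apply: cvg_trans (lim _ Pv); apply: near_eq_cvg.
by apply: filterS (withinT Omega (nbhs_filter x)) => y /uvO.
Qed.

End mesh_Pr.

(** * Frame bounds and the condition number *)

(** The bounds squeeze [min_coef] between [norm u ^+ 2 / beta] and [norm u ^+ 2 / alpha]. The first
    needs an estimate for every expansion of [u], the second only one good expansion. *)
Lemma condition_number_le (R : realType) (H : lmodType R) (W : set H)
    (I : finType) (phi : I -> H) (norm : H -> R) (alpha beta : R) :
  0 < alpha -> 0 < beta ->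
  (forall c : I -> R, norm (\sum_k c k *: phi k) ^+ 2 <= beta * \sum_k c k ^+ 2) ->
  (forall u, W u -> exists2 c : I -> R, u = \sum_k c k *: phi k &
     alpha * \sum_k c k ^+ 2 <= norm u ^+ 2) ->
  (condition_number W phi norm <= (beta / alpha)%:E)%E.
Proof.
move=> a0 b0 up low; rewrite /condition_number.
have ratio u : W u -> u <> 0 ->
    alpha <= norm u ^+ 2 / min_coef phi u /\ norm u ^+ 2 / min_coef phi u <= beta.
  move=> Wu u0; have [c uc cn] := low u Wu.
  set S := [set \sum_k c k ^+ 2 | c in [set c : I -> R | u = \sum_k c k *: phi k]].
  have Sc : S (\sum_k c k ^+ 2) by exists c.
  (* Nothing is assumed about [norm], so its positivity at [u] is drawn from a nonzero
     coefficient. *)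
  have c0 : 0 < \sum_k c k ^+ 2.
    rewrite lt_neqAle sumr_ge0 ?andbT => [|k _]; last exact: sqr_ge0.
    apply: contra_notN u0 => /eqP/esym c0; rewrite uc big1// => k _.
    have /eqP := psumr_eq0P (fun i (_ : true) => sqr_ge0 (c i)) c0 (i:=k) isT.
    by rewrite sqrf_eq0 => /eqP ->; rewrite scale0r.
  have n0 : 0 < norm u ^+ 2 by apply: lt_le_trans cn; rewrite mulr_gt0.
  have Slb : lbound S (norm u ^+ 2 / beta).
    by move=> _ [e ue <-]; rewrite ler_pdivrMr// mulrC ue; exact: up.
  have m1 : norm u ^+ 2 / beta <= min_coef phi u.
    by apply: lb_le_inf; first by exists (\sum_k c k ^+ 2).
  have m2 : min_coef phi u <= norm u ^+ 2 / alpha.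
    apply: (@le_trans _ _ (\sum_k c k ^+ 2)).
      by apply: ge_inf => //; exists (norm u ^+ 2 / beta).
    by rewrite ler_pdivlMr// mulrC.
  have m0 : 0 < min_coef phi u by apply: lt_le_trans m1; rewrite divr_gt0.
  split; first by rewrite ler_pdivlMr// -ler_pdivlMl// mulrC.
  by rewrite ler_pdivrMr// mulrC -ler_pdivrMr.
have supb : (ereal_sup (frame_ratios W phi norm) <= beta%:E)%E.
  apply: ge_ereal_sup => _ [u [Wu u0] <-].
  by rewrite lee_fin; have [] := ratio u Wu u0.
have : (alpha%:E <= ereal_inf (frame_ratios W phi norm))%E.
  apply: le_ereal_inf_tmp => _ [u [Wu u0] <-].
  by rewrite lee_fin; have [] := ratio u Wu u0.
(* The infimum is [+oo] only if there are no ratios, that is, if [W] has no nonzero element; the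
   quotient is then 0. *)
case: ereal_inf => [i||//] ai; last first.
  by rewrite invey mule0 lee_fin divr_ge0// ltW.
rewrite lee_fin in ai; have i0 := lt_le_trans a0 ai.
rewrite inver gt_eqF//.
apply: (@le_trans _ _ (beta%:E * (i^-1)%:E)%E).
  by apply: lee_wpmul2r => //; rewrite lee_fin invr_ge0 ltW.
by rewrite -EFinM lee_fin ler_pM2l// lef_pV2.
Qed.

Lemma sum_tagged (A : nmodType) (J : finType) (N : J -> nat)
    (F : {j : J & 'I_(N j)} -> A) :
  \sum_k F k = \sum_(j : J) \sum_(k < N j) F (Tagged (fun j => 'I_(N j)) k).
Proof.
rewrite (sig_big_dep predT (fun _ => predT)
  (fun j (k : 'I_(N j)) => F (Tagged (fun j => 'I_(N j)) k))).
by apply: eq_bigr => -[].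
Qed.


Theorem corollary3p1 (R : realType) (d : nat) (Omega : set 'rV[R]_d)
    (M : simplicial_mesh Omega) (r : nat) (a b : R)
    (B : Delta M -> ('rV[R]_d -> R) -> 'rV[R]_d -> R)
    (N : Delta M -> nat)
    (phi : forall f : Delta M, 'I_(N f) -> 'rV[R]_d -> R)
    (alpha0 beta0 : R) :
  bounded_polyhedral_domain Omega ->
  (1 <= r)%N ->
  0 < a -> overlap_constant M a ->
  0 < b -> bubble_transform B b ->
  (forall f : Delta M, is_basis (Qstar (val f) r) (phi f)) ->
  0 < alpha0 -> 0 < beta0 ->
  (forall (f : Delta M) (c : 'I_(N f) -> R),
     alpha0 * \sum_k c k ^+ 2 <= L2norm Omega (\sum_k c k *: phi f k) ^+ 2 /\
     L2norm Omega (\sum_k c k *: phi f k) ^+ 2 <= beta0 * \sum_k c k ^+ 2) ->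
  is_frame (Pr M r) (union_family phi) /\
  (condition_number (Pr M r) (union_family phi) (L2norm Omega) <=
     (a^-1 * b * (alpha0^-1 * beta0))%:E)%E.
Proof.
move=> [oO _ _ bO _] r1 a0 aP b0 BP phiP alpha0_gt0 beta0_gt0 stab.
have ss (f : Delta M) : is_subsimplex (val f) by exact: valP.
have phiQ f k : Qstar (val f) r (phi f k) by exact: (phiP f).1.1.
have phiPr f k : Pr M r (phi f k) by exact: Qstar_Pr (ss f) (phiQ f k).
have up c : L2norm Omega (\sum_k c k *: union_family phi k) ^+ 2 <=
    a^-1 * beta0 * \sum_k c k ^+ 2.
  rewrite sum_tagged -mulrA ler_pdivlMl//.
  pose u f := \sum_k c (Tagged (fun f => 'I_(N f)) k) *: phi f k.
  apply: (@le_trans _ _ (\sum_f L2norm Omega (u f) ^+ 2)).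
    apply: aP => [f|f]; first by apply: Pr_L2 (Pr_sumZ _ (phiPr f)).
    apply/aeW => x [Ox xf]; rewrite /u fct_sumE big1// => k _.
    by rewrite scalrfctE /union_family /= (Qstar_eq0 (ss f) (phiQ f k) xf) scaler0.
  by rewrite sum_tagged mulr_sumr ler_sum// => f _; exact: (stab f _).2.
have low u : Pr M r u -> exists2 c, u = \sum_k c k *: union_family phi k &
    alpha0 / b * \sum_k c k ^+ 2 <= L2norm Omega u ^+ 2.
  move=> Pu; have L2u := Pr_L2 oO bO Pu.
  have /choice[q qP] f : exists q, Qstar (val f) r q /\
      B f u = q %[ae lebesgue_rV R d in Omega].
    by have [q] := bubble_local BP f r1 Pu; exists q.
  have qPr f : Pr M r (q f) by exact: Qstar_Pr (ss f) (qP f).1.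
  have c f : {c : 'I_(N f) -> R | q f = \sum_k c k *: phi f k}.
    by apply: cid; exact: (phiP f).1.2 (qP f).1.
  exists (fun k => sval (c (tag k)) (tagged k)).
    rewrite sum_tagged /=.
    under eq_bigr do rewrite -(svalP (c _)).
    apply: (Pr_ae_eq oO Pu).
      by under eq_bigr do rewrite -[q _]scale1r; exact: Pr_sumZ.
    (* There are finitely many [f], so the almost everywhere equalities hold simultaneously almost
       everywhere. *)
    have Bq := filter_forall (ae_filter_ringOfSetsType (lebesgue_rV R d))
      (fun f => (qP f).2).
    move: (bubble_sum BP L2u) Bq; apply: filterS2 => x uE Bq Ox.
    by rewrite -uE// !fct_sumE; apply: eq_bigr => f _; exact: Bq.
  rewrite mulrAC ler_pdivrMr// [leRHS]mulrC.
  apply: le_trans (bubble_stable BP L2u); rewrite [in leLHS]sum_tagged /= mulr_sumr.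
  (* The stability bound concerns [B f u] and the basis bound its representative [q f]; their norms
     agree. *)
  apply: ler_sum => f _; rewrite (L2norm_ae_eq (bubble_L2 BP f L2u) _ (qP f).2).
    by have := (stab f (sval (c f))).1; rewrite -(svalP (c f)).
  exact: Pr_L2 (qPr f).
split.
  split => [[f k]|u Pu]; first exact: phiPr.
  by have [c ? _] := low u Pu; exists c.
(* The constant is the quotient of the upper frame bound from [up] by the lower one from [low]. *)
have -> : a^-1 * b * (alpha0^-1 * beta0) = a^-1 * beta0 / (alpha0 / b).
  by rewrite invf_div [RHS]mulrACA [beta0 / _]mulrC.
apply: condition_number_le => //; first by rewrite divr_gt0.
by rewrite mulr_gt0// invr_gt0.
Qed.
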